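(* Let $p_1$ and $p_2$ be two distinct primes. Then $\min\{\deg f(x): f(x)\in\mathcal{A}_{p_1p_2}\}=p_1p_2-1$.
   Context: For a positive integer $n$, $\Phi_n(x)$ denotes the $n$-th cyclotomic polynomial and $\mathcal{A}_n$ is the set of polynomials $f(x)\in\mathbb{Z}[x]$ such that $\Phi_n(x)$ divides $f(x)$ and $f(x)=x^m-a_{m-1}x^{m-1}-\cdots-a_1x-1$ for some integer $m<n$ with $a_i\in\{0,1\}$ for $1\le i<m$. *)

(* Defs.v *)
From HB Require Import structures.
From mathcomp Require Import all_boot all_order all_algebra all_field.
Set Implicit Arguments.
Unset Strict Implicit.
Unset Printing Implicit Defensive.
Import Order.TTheory GRing.Theory Num.Theory.
Local Open Scope ring_scope.

(* Divisibility in Z[x] is spelled out because %| on {poly int} is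
   pseudo-division.  The condition 0 < m excludes the degenerate reading of
   x^m - ... - 1 as x^0 - 1 = 0 (the form has a leading and a constant term). *)
Definition calA (n : nat) (f : {poly int}) : Prop :=
  (exists q : {poly int}, f = q * 'Phi_n) /\
  exists (m : nat) (a : nat -> int),
    [/\ (0 < m < n)%N,
        forall i : nat, (1 <= i < m)%N -> a i = 0 \/ a i = 1
      & f = 'X^m - \sum_(1 <= i < m) a i *: 'X^i - 1].

Definition deg (f : {poly int}) : nat := (size f).-1.

Definition is_min (S : nat -> Prop) (d : nat) : Prop :=
  S d /\ forall e : nat, S e -> (d <= e)%N.

(* Main.v *)
Require Import Defs.
From HB Require Import structures.
From mathcomp Require Import all_boot all_order all_algebra all_field.
From mathcomp Require Import zify ring.
Import Order.TTheory GRing.Theory Num.Theory.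
Local Open Scope ring_scope.

(** Write [n = p q] and choose [s + t = n + 1] with [p | s] and [q | t].  The
    identity [(X^p - 1)(X^q - 1) Phi_n = (X^n - 1)(X - 1)] shows that
    [X^n - 1] divides [f (X^s - 1)(X^t - 1)] whenever [Phi_n] divides [f], so
    with indices modulo [n] the coefficients of [f] satisfy
    [f_(k+1) + f_k = f_(k+1-s) + f_(k+1-t)].  If [f] in [A_n] had degree
    [m < n - 1], then at [k = m] the left side would be [0 + 1], while the
    right side would be nonpositive.  Degree [n - 1] is attained by
    [X^(p-1) Phi_q(X^p) + X^(q-1) Phi_p(X^q) - (1 + X + ... + X^(n-1))]. *)

Lemma coprime_distinct_primes p q :
  prime p -> prime q -> p <> q -> coprime p q.
Proof.
by move=> p_pr q_pr pq; rewrite prime_coprime // dvdn_prime2 //; apply/eqP.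
Qed.

Lemma divisors_prime p : prime p -> perm_eq (divisors p) [:: 1; p]%N.
Proof.
move=> p_pr; have p_gt1 := prime_gt1 p_pr.
apply: uniq_perm; first exact: divisors_uniq.
  by rewrite /= !inE; lia.
move=> d; rewrite -dvdn_divisors ?prime_gt0 // !inE.
apply/idP/idP; first by case/primeP: p_pr => _; apply.
by case/orP => /eqP ->; rewrite ?dvd1n ?dvdnn.
Qed.

Lemma divisors_mul_primes p q : prime p -> prime q -> p <> q ->
  perm_eq (divisors (p * q)) [:: 1; p; q; p * q]%N.
Proof.
move=> p_pr q_pr pq_neq.
have p_gt1 := prime_gt1 p_pr; have q_gt1 := prime_gt1 q_pr.
apply: uniq_perm; first exact: divisors_uniq.
  by rewrite /= !inE; nia.
move=> d; rewrite -dvdn_divisors ?muln_gt0; last by lia.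
rewrite !inE; apply/idP/idP; last first.
  case/or4P => /eqP ->;
    [exact: dvd1n | exact: dvdn_mulr | exact: dvdn_mull | exact: dvdnn].
have [/dvdnP[e ->]|ndvd_pd] := boolP (p %| d)%N.
  rewrite mulnC dvdn_pmul2l ?prime_gt0 //.
  by case/primeP: q_pr => _ /[apply] /orP [] /eqP ->;
    rewrite ?muln1 eqxx ?orbT.
rewrite Gauss_dvdr; last by rewrite coprime_sym prime_coprime.
by case/primeP: q_pr => _ /[apply] /orP [] /eqP ->; rewrite eqxx ?orbT.
Qed.

Lemma Cyclotomic1 : 'Phi_1 = 'X - 1.
Proof.
by rewrite -['X]expr1 -prod_Cyclotomic // big_cons big_nil mulr1.
Qed.

Lemma prod_Cyclotomic_prime p : prime p -> 'Phi_1 * 'Phi_p = 'X^p - 1.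
Proof.
move=> p_pr; rewrite -prod_Cyclotomic ?prime_gt0 //.
by rewrite (perm_big _ (divisors_prime p p_pr)) /= !big_cons big_nil mulr1.
Qed.

Lemma prod_Cyclotomic_mul_primes p q : prime p -> prime q -> p <> q ->
  'Phi_1 * ('Phi_p * ('Phi_q * 'Phi_(p * q))) = 'X^(p * q) - 1.
Proof.
move=> p_pr q_pr pq_neq; rewrite -prod_Cyclotomic ?muln_gt0 ?prime_gt0 //.
rewrite (perm_big _ (divisors_mul_primes p q p_pr q_pr pq_neq)) /=.
by rewrite !big_cons big_nil mulr1.
Qed.

(** The left side is [Phi_q(X^p)]. Times [X^p - 1] it telescopes to [X^(pq) - 1], and
    [X^p - 1 = Phi_1 Phi_p] is then cancelled from the full factorization. *)
Lemma geometric_mul_primes p q : prime p -> prime q -> p <> q ->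
  \sum_(i < q) 'X^p ^+ i = 'Phi_q * 'Phi_(p * q).
Proof.
move=> p_pr q_pr pq_neq.
have nz : 'X^p - 1 != 0 :> {poly int}.
  by rewrite monic_neq0 // monicXnsubC ?prime_gt0.
apply: (mulfI nz); rewrite -subrX1 -exprM -prod_Cyclotomic_mul_primes //.
by rewrite -prod_Cyclotomic_prime // !mulrA.
Qed.

Lemma geometric_Cyclotomic_mul_primes p q : prime p -> prime q -> p <> q ->
  \sum_(i < p * q) 'X ^+ i = 'Phi_p * ('Phi_q * 'Phi_(p * q)).
Proof.
move=> p_pr q_pr pq_neq.
have nz : 'X - 1 != 0 :> {poly int} by rewrite polyXsubC_eq0.
by apply: (mulfI nz); rewrite -subrX1 -prod_Cyclotomic_mul_primes // Cyclotomic1.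
Qed.

(** The exponents present are [p - 1 + p i] with [i < q], the predecessors of the positive multiples
    of [p] up to [pq]. Taking [p = 1] covers the all-ones polynomial too. *)
Lemma coef_geometric_shift p q k : (0 < p)%N ->
  ('X^(p.-1) * \sum_(i < q) 'X^p ^+ i : {poly int})`_k =
    ((k < p * q) && (p %| k.+1))%N%:R.
Proof.
move=> p_gt0; rewrite mulr_sumr coef_sum.
under eq_bigr => i _ do rewrite -exprM -exprD coefXn.
have [/andP[k_lt /dvdnP[[|t] Dk]]|ndvd] :=
  boolP ((k < p * q) && (p %| k.+1))%N; first by lia.
  have t_lt : (t < q)%N by nia.
  rewrite (bigD1 (Ordinal t_lt)) //= big1 ?addr0 => [|i].
    by have -> : (k == p.-1 + p * t)%N by nia.
  rewrite -val_eqE /= => neq; have -> // : (k == p.-1 + p * i)%N = false.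
  by apply/negbTE/eqP => ek; move/eqP: neq; nia.
rewrite big1 // => i _.
have -> // : (k == p.-1 + p * i)%N = false.
apply/negP => /eqP ek; move/negP: ndvd; apply.
have -> : k.+1 = (p * i.+1)%N by lia.
rewrite dvdn_mulr // andbT; have := ltn_ord i; nia.
Qed.

Lemma coef_calA m (a : nat -> int) k :
  (0 < m)%N ->
  ('X^m - \sum_(1 <= i < m) a i *: 'X^i - 1 : {poly int})`_k =
    if k == m then 1 else if k == 0%N then -1
    else if (k < m)%N then - a k else 0.
Proof.
move=> m_gt0; rewrite !coefB coefXn coef1 coef_sum.
under eq_bigr => i _ do rewrite coefZ coefXn.
have [k_in|k_out] := boolP (1 <= k < m)%N.
  rewrite (bigD1_seq k) ?mem_index_iota ?iota_uniq //= eqxx mulr1.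
  rewrite big1 => [|i]; last by rewrite eq_sym => /negbTE ->; rewrite mulr0.
  have -> : (k == m) = false by lia.
  have -> : (k == 0%N) = false by lia.
  have -> : (k < m)%N by lia.
  by rewrite /=; ring.
rewrite big_nat big1 => [|i i_in]; last first.
  have -> : (k == i) = false by lia.
  by rewrite mulr0.
case: eqP => [->|km]; first by have -> : (m == 0%N) = false by lia.
case: eqP => [_|k0] //.
by have -> : (k < m)%N = false by lia.
Qed.

Lemma deg_calA m (a : nat -> int) : (0 < m)%N ->
  deg ('X^m - \sum_(1 <= i < m) a i *: 'X^i - 1) = m.
Proof.
move=> m_gt0; rewrite /deg; set f := _ - 1.
suff -> : size f = m.+1 by [].
apply/eqP; rewrite eqn_leq; apply/andP; split.
  apply/leq_sizeP => j j_gt; rewrite coef_calA //.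
  by do !case: ifP => //; lia.
by rewrite ltnNge; apply/negP => /leq_sizeP /(_ m (leqnn _));
  rewrite coef_calA // eqxx.
Qed.

Lemma calA_mul_primes_top p q : prime p -> prime q -> p <> q ->
  exists f, calA (p * q) f /\ deg f = (p * q - 1)%N.
Proof.
move=> p_pr q_pr pq_neq.
have p_gt1 := prime_gt1 p_pr; have q_gt1 := prime_gt1 q_pr.
have cop := coprime_distinct_primes p q p_pr q_pr pq_neq.
have pq_gt : (3 < p * q)%N by nia.
(* Negated coefficients of the extremal polynomial: each progression contributes one term and the
   all-ones sum is subtracted. *)
pose a i : int := 1 - (p %| i.+1)%N%:R - (q %| i.+1)%N%:R.
exists ('X^(p * q - 1) - \sum_(1 <= i < p * q - 1) a i *: 'X^i - 1).
split; last by rewrite deg_calA //; lia.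
split; last first.
  exists (p * q - 1)%N, a; split => //; first by lia.
  move=> i i_in; rewrite /a.
  (* If both primes divided [i + 1], so would [pq], although [0 < i + 1 < pq]; hence [a i] cannot be
     [-1]. *)
  have: ~~ ((p %| i.+1) && (q %| i.+1))%N.
    by rewrite -Gauss_dvd //; apply/negP => /dvdn_leq; lia.
  by case: (p %| _)%N; case: (q %| _)%N => //= _; auto.
(* This cofactor is what remains after taking [Phi_(pq)] out of [Phi_q(X^p)], [Phi_p(X^q)] and the
   all-ones sum [Phi_p Phi_q Phi_(pq)]. *)
exists ('X^(p.-1) * 'Phi_q + 'X^(q.-1) * 'Phi_p - 'Phi_p * 'Phi_q).
have -> : ('X^(p.-1) * 'Phi_q + 'X^(q.-1) * 'Phi_p - 'Phi_p * 'Phi_q)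
      * 'Phi_(p * q)
    = 'X^(p.-1) * (\sum_(i < q) 'X^p ^+ i) + 'X^(q.-1) * (\sum_(i < p) 'X^q ^+ i)
      - 'X^0 * (\sum_(i < p * q) 'X^1 ^+ i).
  have pq_neq' : q <> p by move=> e; apply: pq_neq.
  rewrite geometric_mul_primes // geometric_mul_primes // (mulnC q p).
  by rewrite expr1 geometric_Cyclotomic_mul_primes //; ring.
apply/polyP => k; rewrite coef_calA; last by lia.
rewrite coefB coefD !coef_geometric_shift //; try lia.
rewrite (coef_geometric_shift 1) // mul1n dvd1n (mulnC q p) andbT.
case: eqP => [->|kn].
  have -> : (p * q - 1 < p * q)%N by lia.
  have -> : (p * q - 1).+1 = (p * q)%N by lia.
  by rewrite dvdn_mulr // dvdn_mull.
(* The constant term is [-1] since neither prime divides [1]; the leading one above was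
   [1 + 1 - 1]. *)
case: eqP => [->|k0].
  by rewrite !dvdn1 !gtn_eqF ?andbF //= ; have -> : (0 < p * q)%N by lia.
case: ifP => k_lt; last by have -> : (k < p * q)%N = false by lia.
have -> : (k < p * q)%N by lia.
by rewrite /a /=; ring.
Qed.

(** Take the residue [c] below [pq] with [c = 0] mod [p] and [c = 1] mod [q]. Then [q] divides
    [pq + 1 - c], and both parts are positive. *)
Lemma bezout_mul_add1 p q : (1 < p)%N -> (1 < q)%N -> coprime p q ->
  exists u v, [/\ (0 < u)%N, (0 < v)%N & p * u + q * v = (p * q).+1]%N.
Proof.
move=> p_gt1 q_gt1 cop.
pose c := (chinese p q 0 1 %% (p * q))%N.
have c_lt : (c < p * q)%N by rewrite ltn_mod; nia.
have /dvdnP[u Du] : (p %| c)%N.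
  by rewrite /dvdn modn_dvdm ?dvdn_mulr // chinese_modl // mod0n.
have c_modq : c = 1 %[mod q].
  by rewrite modn_dvdm ?dvdn_mull // chinese_modr.
have c_gt0 : (0 < c)%N.
  by rewrite lt0n; apply/eqP => c0; move: c_modq; rewrite c0 mod0n modn_small.
have /dvdnP[v Dv] : (q %| (p * q).+1 - c)%N.
  rewrite -eqn_mod_dvd; last by lia.
  by rewrite c_modq -addn1 -modnDml modnMl.
by exists u, v; split; nia.
Qed.

(** A multiple of [X^n - 1] has coefficient sum zero over each residue class mod [n]; the size bound
    leaves only [k] and [k + n] in this class. *)
Lemma cyclic_coef_multiple_eq0 n k (g h : {poly int}) :
  g = h * ('X^n - 1) -> (k < n)%N -> (size g <= k + n + n)%N ->
  g`_k + g`_(k + n) = 0.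
Proof.
move=> Dg k_lt g_size.
have h0 : h`_(k + n) = 0.
  have [->|h_nz] := eqVneq h 0; first by rewrite coef0.
  have n_gt0 : (0 < n)%N by lia.
  have := size_Mmonic h_nz (monicXnsubC (1 : int) n_gt0).
  rewrite size_XnsubC // -Dg => sz.
  have h_size : (size h <= k + n)%N by lia.
  exact: nth_default.
rewrite Dg mulrBr mulr1 !coefB !coefMXn k_lt.
have -> : (k + n < n)%N = false by lia.
by rewrite addnK h0; ring.
Qed.

Lemma calA_mul_primes_min p q f : prime p -> prime q -> p <> q ->
  calA (p * q) f -> (p * q - 1 <= deg f)%N.
Proof.
move=> p_pr q_pr pq_neq [[g Dg] [m [a [/andP[m_gt0 m_lt] a01 Df]]]].
have p_gt1 := prime_gt1 p_pr; have q_gt1 := prime_gt1 q_pr.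
have cop := coprime_distinct_primes p q p_pr q_pr pq_neq.
have degf : deg f = m by rewrite Df deg_calA.
have fE k : f`_k = if k == m then 1 else if k == 0%N then -1
    else if (k < m)%N then - a k else 0 by rewrite Df coef_calA.
have f_le0 (k : nat) : k != m -> f`_k <= 0.
  move=> km; rewrite fE (negbTE km); case: eqP => // k0.
  by case: ifP => // k_lt; have [|->|->] := a01 k; lia.
rewrite degf leqNgt; apply/negP => m_small.
have [u [v [u_gt0 v_gt0 uv]]] := bezout_mul_add1 p q p_gt1 q_gt1 cop.
set s := (p * u)%N in uv; set t := (q * v)%N in uv.
have s_gt1 : (1 < s)%N by rewrite /s; nia.
have t_gt1 : (1 < t)%N by rewrite /t; nia.
(* This is [f (X^s - 1)(X^t - 1)] expanded with [s + t = pq + 1], so its coefficients are read off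
   from shifts of [f]. *)
pose F := f - f * 'X^s - f * 'X^t + f * 'X^((p * q).+1).
have [h Dh] : exists h, F = h * ('X^(p * q) - 1).
  (* The two sums are [(X^s - 1)/(X^p - 1)] and [(X^t - 1)/(X^q - 1)]. *)
  exists (g * ('X - 1) * (\sum_(i < u) 'X^p ^+ i) * (\sum_(i < v) 'X^q ^+ i)).
  have -> : F = f * (('X^p ^+ u - 1) * ('X^q ^+ v - 1)).
    by rewrite /F -uv exprD -!exprM; ring.
  rewrite (subrX1 _ u) (subrX1 _ v) Dg
    -prod_Cyclotomic_mul_primes // -!prod_Cyclotomic_prime //.
  by rewrite Cyclotomic1; ring.
have f_eq0 k : (m < k)%N -> f`_k = 0.
  by rewrite fE; do !case: ifP => //; lia.
have FE k : F`_k = f`_k - (if (k < s)%N then 0 else f`_(k - s))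
    - (if (k < t)%N then 0 else f`_(k - t))
    + (if (k < (p * q).+1)%N then 0 else f`_(k - (p * q).+1)).
  by rewrite /F !(coefD, coefN, coefMXn).
have F_size : (size F <= m.+1 + p * q + p * q)%N.
  apply/leq_sizeP => j j_ge; rewrite FE.
  have -> : (j < s)%N = false by lia.
  have -> : (j < t)%N = false by lia.
  have -> : (j < (p * q).+1)%N = false by lia.
  by rewrite !f_eq0 //; lia.
have := cyclic_coef_multiple_eq0 _ _ _ _ Dh (_ : m.+1 < p * q)%N F_size.
move=> /(_ ltac:(lia)); rewrite !FE.
have -> : f`_m.+1 = 0 by exact: f_eq0.
have -> : f`_(m.+1 + p * q) = 0 by apply: f_eq0; lia.
have -> : (m.+1 < (p * q).+1)%N by lia.
have -> : (m.+1 + p * q < (p * q).+1)%N = false by lia.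
have -> : (m.+1 + p * q < s)%N = false by lia.
have -> : (m.+1 + p * q < t)%N = false by lia.
have -> : (m.+1 + p * q - (p * q).+1 = m)%N by lia.
have -> : f`_m = 1 by rewrite fE eqxx.
(* No index here is [m]: [s] and [t] are at least 2, hence at most [pq - 1], and a truncated
   difference gives [0 < m]. So [f_m = 1] is the only positive coefficient, and the vanishing sum
   becomes 1 plus nonnegative terms. *)
have Hs := f_le0 (m.+1 + p * q - s)%N ltac:(lia).
have Ht := f_le0 (m.+1 + p * q - t)%N ltac:(lia).
have Hs' := f_le0 (m.+1 - s)%N ltac:(lia).
have Ht' := f_le0 (m.+1 - t)%N ltac:(lia).
by case: ifP => _; case: ifP => _; lia.
Qed.

Theorem theorem3p14 (p1 p2 : nat) (hp1 : prime p1) (hp2 : prime p2)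
    (hp12 : p1 <> p2) :
  is_min (fun d => exists f : {poly int}, calA (p1 * p2)%N f /\ deg f = d)
    (p1 * p2 - 1)%N.
Proof.
split; first exact: calA_mul_primes_top.
by move=> e [f [Af <-]]; apply: calA_mul_primes_min.
Qed.
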